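(* Let $\mathcal{G}$ be a $d$-uniform hypergraph with adjacency matrix $\mathbb{A}$, and let $P$ be (the color matrix of) a perfect coloring of $\mathcal{G}$ with $d$-dimensional parameter matrix $\mathbb{S}$. If $(\lambda,x)$ is an eigenpair for $\mathbb{S}$, then $(\lambda,Px)$ is an eigenpair for $\mathbb{A}$.
   Context: A $d$-uniform hypergraph on vertex set $[n]$ has $d$-element hyperedges. Its adjacency matrix $\mathbb{A}$ is the $d$-dimensional array with $a_{(x_1,\dots,x_d)}=1/(d-1)!$ if $\{x_1,\dots,x_d\}$ is a hyperedge, and $0$ otherwise. A coloring is a surjective map $f:[n]\to[k]$ with color matrix $P$ ($n\times k$, $p_{x,i}=1$ iff $f(x)=i$). We use $$(\mathbb{A}\circ P)_{x,j_1,\dots,j_{d-1}}=\sum_{x_1,\dots,x_{d-1}}a_{x,x_1,\dots,x_{d-1}}p_{x_1,j_1}\cdots p_{x_{d-1},j_{d-1}},\qquad (P\circ\mathbb{S})_{x,\beta}=\sum_ip_{x,i}s_{i,\beta}.$$ The coloring is perfect if there is a $d$-dimensional $\mathbb{S}$ of order $k$ with $\mathbb{A}\circ P=P\circ\mathbb{S}$ (equivalently, all vertices of the same color lie in equally many hyperedges of each color range); this $\mathbb{S}$ is the parameter matrix. For a $d$-dimensional matrix $\mathbb{M}$ of order $m$ and $x\in\mathbb{C}^m$, $(\mathbb{M}\circ x)_i=\sum_{i_2,\dots,i_d}m_{i,i_2,\dots,i_d}x_{i_2}\cdots x_{i_d}$ and $\mathbb{I}\circ x=(x_1^{d-1},\dots,x_m^{d-1})$.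 A pair $(\lambda,x)$ with $\lambda\in\mathbb{C}$ and $x\neq0$ is an eigenpair of $\mathbb{M}$ if $\mathbb{M}\circ x=\lambda(\mathbb{I}\circ x)$. *)

(* Defs.v *)
From HB Require Import structures.
From mathcomp Require Import all_boot all_order all_algebra.
From mathcomp Require Import reals.
From mathcomp Require Export complex.

Set Implicit Arguments.
Unset Strict Implicit.
Unset Printing Implicit Defensive.

Import Order.TTheory GRing.Theory Num.Theory.
Local Open Scope ring_scope.

(* The field of complex numbers is [R[i]] for [R : realType].

   Dimensions and uniformities are written [d.+1] wherever a first index is
   separated from the remaining ones: the informal "d" is [d.+1] and the
   informal "d - 1" is [d]. *)

Record hypergraph (d n : nat) := Hypergraph {
  hyperedges : {set {set 'I_n}};
  hyperedges_uniform : forall e, e \in hyperedges -> #|e| = d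
}.

Definition array (R : realType) (d m : nat) := d.-tuple 'I_m -> R[i].

Definition adjacency (R : realType) (d n : nat) (G : hypergraph d.+1 n) :
    array R d.+1 n :=
  fun t => if [set y in t] \in hyperedges G then (d`!%:R)^-1 else 0.

Definition surjective (n k : nat) (f : 'I_n -> 'I_k) :=
  forall i, exists x, f x = i.

Definition color_matrix (R : realType) (n k : nat) (f : 'I_n -> 'I_k) :
    'M[R[i]]_(n, k) :=
  \matrix_(x, i) (f x == i)%:R.

(* The arrays A o P and P o S have a first index in [n] and all others in [k],
   hence the separate first argument. *)
Definition array_mul_mx (R : realType) (d n k : nat)
    (A : array R d.+1 n) (P : 'M[R[i]]_(n, k)) : 'I_n -> d.-tuple 'I_k -> R[i] :=
  fun x b => \sum_(t : d.-tuple 'I_n)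
    A [tuple of x :: t] * \prod_(l < d) P (tnth t l) (tnth b l).

Definition mx_mul_array (R : realType) (d n k : nat)
    (P : 'M[R[i]]_(n, k)) (S : array R d.+1 k) : 'I_n -> d.-tuple 'I_k -> R[i] :=
  fun x b => \sum_(i < k) P x i * S [tuple of i :: b].

Definition parameter_matrix (R : realType) (d n k : nat)
    (G : hypergraph d.+1 n) (f : 'I_n -> 'I_k) (S : array R d.+1 k) :=
  forall x b, array_mul_mx (adjacency R G) (color_matrix R f) x b
            = mx_mul_array (color_matrix R f) S x b.

Definition perfect_coloring (R : realType) (d n k : nat)
    (G : hypergraph d.+1 n) (f : 'I_n -> 'I_k) :=
  surjective f /\ exists S : array R d.+1 k, parameter_matrix G f S.

Definition array_mul_vec (R : realType) (d m : nat)
    (M : array R d.+1 m) (x : 'cV[R[i]]_m) : 'cV[R[i]]_m :=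
  \col_i \sum_(t : d.-tuple 'I_m)
    M [tuple of i :: t] * \prod_(l < d) x (tnth t l) 0.

(* I o x for the identity array I of dimension d.+1. *)
Definition id_array_mul_vec (R : realType) (d m : nat) (x : 'cV[R[i]]_m) :
    'cV[R[i]]_m :=
  \col_i x i 0 ^+ d.

Definition eigenpair (R : realType) (d m : nat)
    (M : array R d.+1 m) (lambda : R[i]) (x : 'cV[R[i]]_m) :=
  x <> 0 /\ array_mul_vec M x = lambda *: id_array_mul_vec d x.

(* Main.v *)
Require Import Defs.
From mathcomp Require Import all_boot all_order all_algebra.
From mathcomp Require Import reals complex.

(** Associativity gives [A o (P x) = (A o P) o x = (P o S) o x = P (S o x)],
    which equals [lambda P (I o x)].  Since [(P x)_y = x_(f y)], the color
    matrix commutes with entrywise powers, so this is [lambda (I o (P x))];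
    and [P x <> 0] because the coloring is surjective. *)

Import GRing.Theory.
Local Open Scope ring_scope.

(** Array entries are indexed by tuples, while [bigA_distr_bigA] sums over finite functions; [tnth]
    is a bijection between the two index sets. *)
Lemma bigA_distr_tuple (R : comPzSemiRingType) (d k : nat)
    (F : 'I_d -> 'I_k -> R) :
  \prod_(l < d) \sum_(i < k) F l i
  = \sum_(b : d.-tuple 'I_k) \prod_(l < d) F l (tnth b l).
Proof.
rewrite bigA_distr_bigA.
rewrite (reindex (fun b : d.-tuple 'I_k => [ffun l => tnth b l])) /=.
  by apply: eq_bigr => b _; apply: eq_bigr => l _; rewrite ffunE.
exists (fun g : {ffun 'I_d -> 'I_k} => [tuple g l | l < d]) => [b _|g _].
  by apply: eq_from_tnth => l; rewrite tnth_mktuple ffunE.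
by apply/ffunP => l; rewrite ffunE tnth_mktuple.
Qed.

(** Each entry of [P *m x] is a sum over colors, so a product of [d] of them expands into a sum over
    color tuples [b]. The right side is (A o P) o x, written out because A o P has indices of two
    ranges and is not an [array]. *)
Lemma array_mul_vec_mulmx (R : realType) (d n k : nat) (A : array R d.+1 n)
    (P : 'M[R[i]]_(n, k)) (x : 'cV[R[i]]_k) :
  array_mul_vec A (P *m x)
  = \col_y \sum_(b : d.-tuple 'I_k)
      array_mul_mx A P y b * \prod_(l < d) x (tnth b l) 0.
Proof.
apply/colP => y; rewrite !mxE.
under [RHS]eq_bigr => b _ do rewrite big_distrl.
rewrite exchange_big; apply: eq_bigr => t _ /=.
under eq_bigr => l _ do rewrite mxE.
rewrite bigA_distr_tuple big_distrr; apply: eq_bigr => b _ /=.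
by rewrite big_split mulrA.
Qed.

(** Here [P] meets only the first index of [S], so exchanging the two sums suffices. *)
Lemma mulmx_array_mul_vec (R : realType) (d n k : nat) (P : 'M[R[i]]_(n, k))
    (S : array R d.+1 k) (x : 'cV[R[i]]_k) :
  P *m array_mul_vec S x
  = \col_y \sum_(b : d.-tuple 'I_k)
      mx_mul_array P S y b * \prod_(l < d) x (tnth b l) 0.
Proof.
apply/colP => y; rewrite !mxE.
under [RHS]eq_bigr => b _ do rewrite big_distrl.
rewrite exchange_big; apply: eq_bigr => i _ /=.
by rewrite mxE big_distrr; apply: eq_bigr => b _; rewrite /= mulrA.
Qed.

Lemma color_matrix_mulE (R : realType) (n k : nat) (f : 'I_n -> 'I_k)
    (x : 'cV[R[i]]_k) (y : 'I_n) :
  (color_matrix R f *m x) y 0 = x (f y) 0.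
Proof.
rewrite mxE (bigD1 (f y)) //= mxE eqxx mul1r big1 ?addr0 // => i.
by rewrite mxE eq_sym => /negPf ->; rewrite mul0r.
Qed.

Lemma color_matrix_mul_id_array (R : realType) (d n k : nat)
    (f : 'I_n -> 'I_k) (x : 'cV[R[i]]_k) :
  color_matrix R f *m id_array_mul_vec d x
  = id_array_mul_vec d (color_matrix R f *m x).
Proof.
apply/colP => y; rewrite color_matrix_mulE.
by rewrite [LHS]mxE [RHS]mxE color_matrix_mulE.
Qed.

Lemma color_matrix_mul_eq0 (R : realType) (n k : nat) (f : 'I_n -> 'I_k)
    (x : 'cV[R[i]]_k) :
  surjective f -> color_matrix R f *m x = 0 -> x = 0.
Proof.
move=> f_surj Px0; apply/colP => i; have [y <-] := f_surj i.
by rewrite -color_matrix_mulE Px0 !mxE.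
Qed.

Theorem theorem8 (R : realType) (d n k : nat) (G : hypergraph d.+1 n)
    (f : 'I_n -> 'I_k) (S : array R d.+1 k) (lambda : R[i]) (x : 'cV[R[i]]_k) :
  perfect_coloring R G f ->
  parameter_matrix G f S ->
  eigenpair S lambda x ->
  eigenpair (adjacency R G) lambda (color_matrix R f *m x).
Proof.
move=> [f_surj _] AP_PS [x_neq0 Sx]; split.
  by move=> /(color_matrix_mul_eq0 _ _ _ _ _ f_surj).
(* The right side becomes P (S o x); both sides then are sums over color tuples with the same
   products of entries of [x], and [AP_PS] matches their coefficients. *)
rewrite -color_matrix_mul_id_array scalemxAr -Sx.
rewrite array_mul_vec_mulmx mulmx_array_mul_vec.
by apply/colP => y; rewrite !mxE; apply: eq_bigr => b _; rewrite AP_PS.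
Qed.
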